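(* The envelope of any tangential family germ having a singularity $\mathrm{I}$ is smooth, while the envelope of any tangential family germ having a singularity $\mathrm{II}$ has an order $2$ self-tangency.
   Context: All objects are $C^\infty$. Let $(\xi,t)$ be coordinates on the source plane. A tangential family germ is a map germ $f:(\mathbb{R}^2,0)\to(\mathbb{R}^2,0)$ such that $\partial_\xi f$ and $\partial_t f$ are parallel nonzero vectors at every point $(\xi,t=0)$ near the origin; the image of $f(\cdot,0)$ is a (germ of an) embedded curve called the support $\gamma$. The graph of the family is the surface $\Phi=\{(q,p): q=f(\xi,0),\ p=f(\xi,t)\}\subset\gamma\times\mathbb{R}^2$ (a smooth surface germ, parameterized by $(\xi,t)$), with projection $\pi_2:\Phi\to\mathbb{R}^2$, $(q,p)\mapsto p$. The envelope is the set of critical values of $\pi_2$, equivalently the critical value set of $f$ (the image under $f$ of $\{\det Df=0\}$). It contains the support. Two map germs $f,g:(\mathbb{R}^2,0)\to(\mathbb{R}^2,0)$ are $\mathcal{A}$-equivalent if $g=\psi\circ f\circ\phi^{-1}$ for diffeomorphism germs $\phi,\psi$ of $(\mathbb{R}^2,0)$. A tangential family germ has a singularity $\mathrm{I}$ (resp. $\mathrm{II}$) if it is $\mathcal{A}$-equivalent to the germ at the origin of $(\xi,t)\mapsto(\xi+t,t^2)$ (resp. $(\xi,t)\mapsto(\xi+t,t^2\xi)$). Order $k$ tangency: two smooth curve germs at the origin have an order $k$ tangency if, in suitable local coordinates $(x,y)$, one is $y=0$ and the other is the graph $y=\varphi(x)$ with $\varphi(x)=c\,x^{k+1}+o(x^{k+1})$,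 $c\neq0$. A germ of set has an order $2$ self-tangency if it is the union of two smooth branches with an order $2$ tangency at the origin. *)

(* Defs.v *)
(* MathComp / MathComp-Analysis *)
From HB Require Import structures.
From mathcomp Require Import all_boot all_order all_algebra.
From mathcomp Require Import all_classical all_reals all_analysis.

Set Implicit Arguments.
Unset Strict Implicit.
Unset Printing Implicit Defensive.

Import Order.TTheory GRing.Theory Num.Theory.
Import numFieldNormedType.Exports.

Local Open Scope classical_set_scope.
Local Open Scope ring_scope.

(* Germs at the origin are represented by total functions (resp. sets), of
   which only the behaviour near 0 is ever used: equality of germs is equality
   (resp. equivalence) on a neighbourhood of 0. *)

(* The class C^n on the open set U, n >= 0; quantifying over all directions v
   covers the partial derivatives in any basis. *)
Fixpoint Ck (R : realType) (V W : normedModType R) (n : nat) (U : set V)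
    (f : V -> W) : Prop :=
  match n with
  | 0%N => forall x, U x -> {for x, continuous f}
  | n'.+1 => (forall x, U x -> differentiable f x) /\
             (forall v : V, Ck n' U (fun x => 'D_v f x))
  end.

(* A single neighbourhood U serves all the orders n. *)
Definition smooth_germ (R : realType) (V W : normedModType R)
    (f : V -> W) : Prop :=
  exists2 U : set V, open_nbhs (0 : V) U & forall n, Ck n U f.

Section Plane.
Variable R : realType.
Local Notation plane := 'rV[R]_2.

Definition pt (a b : R) : plane := \row_(j < 2) (if j == 0 then a else b).
Definition fst_coord (p : plane) : R := p 0 0.
Definition snd_coord (p : plane) : R := p 0 1.

Definition smooth_map_germ (f : plane -> plane) : Prop :=
  f 0 = 0 /\ smooth_germ f.

Definition inverse_diffeo_germs (h h' : plane -> plane) : Prop :=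
  [/\ smooth_map_germ h, smooth_map_germ h',
      (\forall p \near (0 : plane), h' (h p) = p) &
      (\forall p \near (0 : plane), h (h' p) = p)].

Definition diffeo_germ (h : plane -> plane) : Prop :=
  exists h', inverse_diffeo_germs h h'.

(* g = psi o f o phi^-1 as germs; phi' is the inverse of phi. *)
Definition A_equivalent (f g : plane -> plane) : Prop :=
  exists phi phi' psi : plane -> plane,
    [/\ inverse_diffeo_germs phi phi', diffeo_germ psi &
        \forall p \near (0 : plane), g p = psi (f (phi' p))].

(* The coordinates (xi, t) of the source are (fst_coord, snd_coord). *)
Definition d_xi (f : plane -> plane) (p : plane) : plane := 'D_(pt 1 0) f p.
Definition d_t (f : plane -> plane) (p : plane) : plane := 'D_(pt 0 1) f p.

Definition tangential_family_germ (f : plane -> plane) : Prop :=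
  smooth_map_germ f /\
  \forall xi \near (0 : R),
    [/\ d_xi f (pt xi 0) != 0, d_t f (pt xi 0) != 0 &
        exists c : R, d_t f (pt xi 0) = c *: d_xi f (pt xi 0)].

Definition normal_form_I (p : plane) : plane :=
  pt (fst_coord p + snd_coord p) (snd_coord p ^+ 2).

Definition normal_form_II (p : plane) : plane :=
  pt (fst_coord p + snd_coord p) (snd_coord p ^+ 2 * fst_coord p).

Definition has_singularity_I (f : plane -> plane) : Prop :=
  A_equivalent f normal_form_I.

Definition has_singularity_II (f : plane -> plane) : Prop :=
  A_equivalent f normal_form_II.

(* The parameterization (xi, t) |-> (q, p) = (f (xi, 0), f (xi, t)) of the
   graph Phi of the family. *)
Definition graph_param (f : plane -> plane) (p : plane) : plane * plane :=
  (f (pt (fst_coord p) 0), f p).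

(* pi_2 on Phi, read in the parameterization above; as a function of (xi, t)
   it is f itself. *)
Definition pi2_graph (f : plane -> plane) : plane -> plane :=
  fun p => (graph_param f p).2.

Definition critical_values (F : plane -> plane) (U : set plane) : set plane :=
  F @` [set p | U p /\ \det ('J F p) = 0].

(* The image of a germ of set under a map germ may depend on the neighbourhood
   on which it is computed. The set E represents the envelope when, for every
   small enough neighbourhood U of 0 in the source, the critical values of the
   restriction to U have the same germ at 0 as E. *)
Definition is_envelope (f : plane -> plane) (E : set plane) : Prop :=
  exists2 U0 : set plane, nbhs (0 : plane) U0 &
    forall U : set plane, nbhs (0 : plane) U -> U `<=` U0 ->
      \forall p \near (0 : plane), E p <-> critical_values (pi2_graph f) U p.

(* The germ of S at 0 is that of a one-dimensional embedded submanifold through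
   0: it is the axis y = 0 in some local coordinates h = (x, y). *)
Definition smooth_curve_germ (S : set plane) : Prop :=
  exists2 h : plane -> plane, diffeo_germ h &
    \forall p \near (0 : plane), S p <-> snd_coord (h p) = 0.

(* The expansion forces phi 0 = 0, since the neighbourhoods of 0 used by the
   little o contain 0. *)
Definition order_tangency (k : nat) (A B : set plane) : Prop :=
  [/\ smooth_curve_germ A, smooth_curve_germ B &
    exists (h : plane -> plane) (phi : R -> R) (c : R),
      [/\ diffeo_germ h,
          smooth_germ (phi : R^o -> R^o),
          c != 0 /\
          (fun x : R^o => phi x - c * x ^+ k.+1 : R^o)
            =o_ (0 : R^o) (fun x : R^o => x ^+ k.+1 : R^o),
          (\forall p \near (0 : plane), A p <-> snd_coord (h p) = 0) &
          (\forall p \near (0 : plane),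
             B p <-> snd_coord (h p) = phi (fst_coord (h p)))]].

Definition self_tangency (k : nat) (S : set plane) : Prop :=
  exists A B : set plane,
    order_tangency k A B /\ \forall p \near (0 : plane), S p <-> A p \/ B p.

End Plane.

(* Main.v *)
Require Import Defs.
From mathcomp Require Import all_boot all_order all_algebra.
From mathcomp Require Import all_classical all_reals all_analysis.
From mathcomp Require Import ring.

(** The envelope transforms naturally under A-equivalence. If
    g = psi o f o phi^-1 with phi and psi diffeomorphism germs, the chain rule
    multiplies the Jacobian determinant by nonzero factors, so phi carries the
    critical points of f to those of g, and psi carries the critical values of
    f to those of g ([is_envelope_A_equivalent]). Smoothness of a curve germ
    and the order of a tangency are read in local coordinates, hence survive
    the pullback by psi ([smooth_curve_germ_preimage],
    [self_tangency_preimage]). It is thus enough to treat the two normal forms.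

    For (xi + t, t^2) the Jacobian determinant is 2 t; the critical set is
    t = 0 and its image is the axis y = 0 ([is_envelope_normal_form_I]).

    For (xi + t, t^2 xi) it is t (2 xi - t). The line t = 0 is again mapped to
    the axis y = 0, and the line t = 2 xi is mapped to the points
    (3 xi, 4 xi^3), that is, to the cubic y = (4/27) x^3
    ([is_envelope_normal_form_II]). The contact of this cubic with the axis is
    an order 2 tangency ([order_tangency_monomial]); the shear
    (x, y) |-> (x, y - c x^3) straightens the cubic, which shows that it is a
    smooth curve.

    As a smooth germ is one all of whose iterated directional derivatives are
    differentiable near 0, the composition of diffeomorphism germs requires the
    closure of the classes C^n under sums, products and composition
    ([Ck_comp]). *)

Set Implicit Arguments.
Unset Strict Implicit.
Unset Printing Implicit Defensive.

Import Order.TTheory GRing.Theory Num.Theory.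
Import numFieldNormedType.Exports.

Local Open Scope classical_set_scope.
Local Open Scope ring_scope.

(** * Maps of class C^n *)

Section Ck_calculus.
Context {R : realType} {V : normedModType R}.

(** Differentiability only depends on the germ: the affine expansion of f at x
    is also one of g. *)
Lemma near_eq_differentiable (W : normedModType R) (f g : V -> W) x :
  (\near x, f x = g x) -> differentiable f x -> differentiable g x.
Proof.
move=> fg /diff_locallyP[dc /eqaddoP fo].
have gxf : g x = f x by rewrite (nbhs_singleton fg).
have go : g \o shift x = cst (g x) + 'd f x +o_ 0 id.
  apply/eqaddoP => e e0; move: (fo e e0).
  move: fg; rewrite (near_shift 0 x) subr0 => fg.
  apply: filterS2 fg => y /= fg.
  by rewrite !fctE fg gxf.
by apply/diff_locallyP; rewrite (diff_unique dc go).
Qed.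

(** Openness of U makes the agreement of f and g on U pass to the derivatives,
    whence the induction on n. *)
Lemma Ck_eq (W : normedModType R) n (U : set V) (f g : V -> W) : open U ->
  (forall x, U x -> f x = g x) -> Ck n U f -> Ck n U g.
Proof.
move=> oU; elim: n f g => [|n IHn] f g fg /=.
  move=> fC x Ux; rewrite /prop_for /continuous_at -fg//.
  apply: cvg_trans (fC x Ux); apply: near_eq_cvg.
  by apply: filterS (open_nbhs_nbhs (conj oU Ux)).
have nfg x : U x -> \near x, f x = g x.
  by move=> Ux; apply: filterS (open_nbhs_nbhs (conj oU Ux)).
move=> [fd fC]; split=> [x Ux|v].
  exact: near_eq_differentiable (nfg x Ux) (fd x Ux).
by apply: IHn (fC v) => x Ux; apply: near_eq_derive; exact: nfg.
Qed.

Lemma Ck_sub (W : normedModType R) n (U U' : set V) (f : V -> W) :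
  U' `<=` U -> Ck n U f -> Ck n U' f.
Proof.
move=> UU; elim: n f => [|n IHn] f /= => [fC x /UU|[fd fC]]; first exact: fC.
by split=> [x /UU|v]; [exact: fd|exact/IHn/fC].
Qed.

Lemma Ck_pred (W : normedModType R) n (U : set V) (f : V -> W) :
  Ck n.+1 U f -> Ck n U f.
Proof.
elim: n f => [|n IHn] f [fd fC] /=.
  by move=> x Ux; apply/differentiable_continuous/fd.
by split=> // v; apply/IHn/fC.
Qed.

Lemma Ck_cst (W : normedModType R) n (U : set V) (w : W) :
  Ck n U (fun=> w : W).
Proof.
elim: n w => [w x Ux|n IHn w /=]; first exact: cvg_cst.
split=> [x Ux|v]; first exact: differentiable_cst.
rewrite (_ : 'D_v _ = fun=> 0)//; apply/funext => x; exact: derive_cst.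
Qed.

Lemma Ck_linear (W : normedModType R) n (U : set V) (f : {linear V -> W}) :
  continuous f -> Ck n U f.
Proof.
move=> fC; case: n => [x _|n /=]; first exact: fC.
split=> [x Ux|v]; first exact: linear_differentiable.
rewrite (_ : 'D_v _ = fun=> f v); first exact: Ck_cst.
apply/funext => x; rewrite deriveE; last exact: linear_differentiable.
by rewrite diff_lin.
Qed.

Lemma CkD (W : normedModType R) n (U : set V) (f g : V -> W) : open U ->
  Ck n U f -> Ck n U g -> Ck n U (f + g).
Proof.
move=> oU; elim: n f g => [|n IHn] f g.
  by move=> fC gC x Ux; apply: cvgD; [exact: fC|exact: gC].
move=> [fd fC] [gd gC]; split=> [x Ux|v].
  by apply: differentiableD; [exact: fd|exact: gd].
apply: Ck_eq (IHn _ _ (fC v) (gC v)) => // x Ux.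
by rewrite deriveD//; apply: diff_derivable; [exact: fd|exact: gd].
Qed.

Lemma Ck_sum (W : normedModType R) n (U : set V) m (f : 'I_m -> V -> W) :
  open U -> (forall i, Ck n U (f i)) -> Ck n U (fun x => \sum_i f i x).
Proof.
move=> oU fC; apply: (@Ck_eq _ _ _ (\sum_i f i)) => //.
  by move=> x _; rewrite fct_sumE.
by elim/big_ind : _ => // [|g h]; [exact: Ck_cst|exact: CkD].
Qed.

Lemma CkM n (U : set V) (f g : V -> R^o) : open U ->
  Ck n U f -> Ck n U g -> Ck n U (f * g : V -> R^o).
Proof.
move=> oU; elim: n f g => [|n IHn] f g.
  by move=> fC gC x Ux; apply: cvgM; [exact: fC|exact: gC].
move=> fC gC; have [fd fdC] := fC; have [gd gdC] := gC.
split=> [x Ux|v].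
  by apply: differentiableM; [exact: fd|exact: gd].
have := CkD oU (IHn _ _ (Ck_pred fC) (gdC v)) (IHn _ _ (Ck_pred gC) (fdC v)).
apply: Ck_eq => // x Ux.
by rewrite deriveM//; apply: diff_derivable; [exact: fd|exact: gd].
Qed.

Lemma CkX n (U : set V) (f : V -> R^o) k : open U ->
  Ck n U f -> Ck n U (fun x => f x ^+ k : R^o).
Proof.
move=> oU fC; elim: k => [|k IHk]; first exact: Ck_cst.
apply: Ck_eq (CkM oU fC IHk) => // x _; exact/esym/exprS.
Qed.

(** Reduces the class of a vector-valued map to that of real functions, for
    which the product rule [CkM] applies. *)
Lemma Ck_coord n (U : set V) m (f : V -> 'rV[R]_m) : open U ->
  Ck n U f <-> forall j, Ck n U (fun x => f x 0 j : R^o).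
Proof.
move=> oU; elim: n f => [|n IHn] f.
  split=> [fC j x Ux|fC x Ux].
    apply: (@continuous_comp _ _ _ f (fun M : 'rV[R]_m => M 0 j)).
      exact: fC.
    exact: coord_continuous.
  rewrite (_ : f = fun x => \sum_j f x 0 j *: 'e_j); last first.
    by apply/funext => y; exact: row_sum_delta.
  rewrite /prop_for /continuous_at; apply: cvg_big => [|j _].
    exact: add_continuous.
  by apply: cvgZr_tmp; exact: fC.
split=> [[fd fC] j|fC].
  split=> [x Ux|v].
    apply: (@differentiable_comp _ _ _ _ f (fun M : 'rV[R]_m => M 0 j)).
      exact: fd.
    exact: differentiable_coord.
  have := (IHn _).1 (fC v) j; apply: Ck_eq => // x Ux.
  by rewrite derive_mx ?mxE//; exact/diff_derivable/fd.
have fd x : U x -> differentiable f x.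
  move=> Ux; rewrite (_ : f = \sum_j fun x => f x 0 j *: 'e_j); last first.
    by apply/funext => y; rewrite fct_sumE; exact: row_sum_delta.
  by apply: differentiable_sum => j; apply: differentiableZl; exact: (fC j).1.
split=> // v; apply/IHn => j; have := (fC j).2 v; apply: Ck_eq => // x Ux.
by rewrite derive_mx ?mxE//; exact/diff_derivable/fd.
Qed.

(** By the chain rule, the derivative of g o f along v is the sum over j of
    (D_v f)_j times (D_(e_j) g) o f, and the induction hypothesis applies to
    the derivatives D_(e_j) g of g. *)
Lemma Ck_comp n (U : set V) m p (W : set 'rV[R]_m) (f : V -> 'rV[R]_m)
    (g : 'rV[R]_m -> 'rV[R]_p) : open U -> open W -> U `<=` f @^-1` W ->
  Ck n U f -> Ck n W g -> Ck n U (g \o f).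
Proof.
move=> oU oW UW; elim: n g => [|n IHn] g fC gC.
  by move=> x Ux; apply: continuous_comp; [exact: fC|exact/gC/UW].
have [[fd fdC] [gd gdC]] := (fC, gC).
split=> [x Ux|v].
  by apply: differentiable_comp; [exact: fd|exact/gd/UW].
apply: (@Ck_eq _ _ _ (fun x => \sum_j 'D_v f x 0 j *: 'D_('e_j) g (f x))) => //.
  move=> x Ux.
  have fdx := fd x Ux; have gdx := gd _ (UW _ Ux).
  rewrite (deriveE _ (differentiable_comp fdx gdx)) (diff_comp fdx gdx) /=.
  rewrite -(deriveE _ fdx) [in RHS](row_sum_delta ('D_v f x)) linear_sum /=.
  by apply: eq_bigr => j _; rewrite linearZ /= (deriveE _ gdx).
apply: Ck_sum => // j; apply/Ck_coord => // k.
have := CkM oU ((Ck_coord n _ oU).1 (fdC v) j)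
  ((Ck_coord n _ oU).1 (IHn _ (Ck_pred fC) (gdC 'e_j)) k).
by apply: Ck_eq => // x _; rewrite !mxE.
Qed.

End Ck_calculus.

(** * Diffeomorphism germs, Jacobians and envelopes *)

Section Germs.
Context {R : realType}.
Local Notation plane := 'rV[R]_2.
Implicit Types (f g psi : plane -> plane) (A B C : set plane).

Lemma smooth_germ_differentiable (V W : normedModType R) (f : V -> W) :
  smooth_germ f -> \forall x \near (0 : V), differentiable f x.
Proof. by move=> [U oU /(_ 1%N)[fd _]]; apply: filterS (open_nbhs_nbhs oU). Qed.

Lemma smooth_germ_continuous (V W : normedModType R) (f : V -> W) :
  smooth_germ f -> {for 0, continuous f}.
Proof.
by move=> /smooth_germ_differentiable/nbhs_singleton/differentiable_continuous.
Qed.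

Lemma smooth_germ_comp (V : normedModType R) m p (f : V -> 'rV[R]_m)
    (g : 'rV[R]_m -> 'rV[R]_p) : f 0 = 0 ->
  smooth_germ f -> smooth_germ g -> smooth_germ (g \o f).
Proof.
move=> f0 [U [oU U0] fC] [W [oW W0] gC].
have oUW : open (U `&` f @^-1` W).
  rewrite openE => x [Ux Wfx]; apply: filterI; first exact: open_nbhs_nbhs.
  by apply: (fC 0%N x Ux); exact: open_nbhs_nbhs.
exists (U `&` f @^-1` W); first by split=> //; split=> //=; rewrite f0.
move=> n; apply: (Ck_comp oUW oW) (gC n) => [x []//|].
by apply: Ck_sub (fC n) => x [].
Qed.

Lemma smooth_map_germ_comp f g :
  smooth_map_germ f -> smooth_map_germ g -> smooth_map_germ (g \o f).
Proof.
move=> [f0 fC] [g0 gC]; split; first by rewrite /= f0.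
exact: smooth_germ_comp.
Qed.

Lemma smooth_map_germ_near f (P : plane -> Prop) : smooth_map_germ f ->
  (\forall p \near (0 : plane), P p) -> \forall p \near (0 : plane), P (f p).
Proof.
by move=> [f0 /smooth_germ_continuous fC] nP; apply: fC; rewrite f0.
Qed.

Lemma inverse_diffeo_germs_comp f f' g g' :
  inverse_diffeo_germs f f' -> inverse_diffeo_germs g g' ->
  inverse_diffeo_germs (g \o f) (f' \o g').
Proof.
move=> [fC f'C ff' f'f] [gC g'C gg' g'g].
split; [exact: smooth_map_germ_comp|exact: smooth_map_germ_comp| |].
  by apply: filterS2 ff' (smooth_map_germ_near fC gg') => p /= + ->.
by apply: filterS2 g'g (smooth_map_germ_near g'C f'f) => p /= + ->.
Qed.

Lemma diffeo_germ_comp f g :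
  diffeo_germ f -> diffeo_germ g -> diffeo_germ (g \o f).
Proof.
move=> [f' ff'] [g' gg']; exists (f' \o g').
exact: inverse_diffeo_germs_comp.
Qed.

Lemma diffeo_germ_smooth f : diffeo_germ f -> smooth_map_germ f.
Proof. by move=> [f' []]. Qed.

Lemma smooth_curve_germ_preimage psi A : diffeo_germ psi ->
  smooth_curve_germ A -> smooth_curve_germ (psi @^-1` A).
Proof.
move=> psiD [h hD hA]; exists (h \o psi); first exact: diffeo_germ_comp.
exact: smooth_map_germ_near (diffeo_germ_smooth psiD) hA.
Qed.

Lemma order_tangency_preimage k psi A B : diffeo_germ psi ->
  order_tangency k A B -> order_tangency k (psi @^-1` A) (psi @^-1` B).
Proof.
move=> psiD [cA cB [h [u [c [hD uC hc hA hB]]]]].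
have psiC := diffeo_germ_smooth psiD.
split; [exact: smooth_curve_germ_preimage|exact: smooth_curve_germ_preimage|].
exists (h \o psi), u, c; split=> //; first exact: diffeo_germ_comp.
  exact: smooth_map_germ_near psiC hA.
exact: smooth_map_germ_near psiC hB.
Qed.

Lemma self_tangency_preimage k psi C : diffeo_germ psi ->
  self_tangency k C -> self_tangency k (psi @^-1` C).
Proof.
move=> psiD [A [B [AB CAB]]]; exists (psi @^-1` A), (psi @^-1` B).
split; first exact: order_tangency_preimage.
exact: smooth_map_germ_near (diffeo_germ_smooth psiD) CAB.
Qed.

(** Jacobian matrices act on row vectors from the right, so the directional
    derivatives along the basis vectors are their rows, and the chain rule
    below multiplies in the order of composition. *)
Lemma row_jacobian m n (f : 'rV[R]_m -> 'rV[R]_n) x i :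
  differentiable f x -> row i ('J f x) = 'D_('e_i) f x.
Proof. by move=> fd; rewrite rowE (deriveEjacobian _ fd). Qed.

Lemma jacobian_comp m n p (f : 'rV[R]_m -> 'rV[R]_n) (g : 'rV[R]_n -> 'rV[R]_p)
    x : differentiable f x -> differentiable g (f x) ->
  'J (g \o f) x = 'J f x *m 'J g (f x).
Proof.
move=> fd gd; have gfd := differentiable_comp fd gd.
apply/row_matrixP => i.
rewrite row_mul (row_jacobian _ fd) (row_jacobian _ gfd).
rewrite (deriveE _ gfd) (diff_comp fd gd) /= -(deriveE _ fd) -(deriveE _ gd).
exact: deriveEjacobian.
Qed.

Lemma near_eq_jacobian m n (f g : 'rV[R]_m -> 'rV[R]_n) x :
  differentiable f x -> (\near x, f x = g x) -> 'J f x = 'J g x.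
Proof.
move=> fd fg; have gd := near_eq_differentiable fg fd.
apply/row_matrixP => i.
apply: etrans (row_jacobian i fd) (etrans _ (esym (row_jacobian i gd))).
exact: near_eq_derive.
Qed.

Lemma jacobian_id n (x : 'rV[R]_n) : 'J id x = 1%:M.
Proof.
have idd : differentiable (@id 'rV[R]_n) x by exact: ex_diff.
by apply/row_matrixP => i; rewrite (row_jacobian _ idd) row1 derive_id.
Qed.

(** The Jacobian matrices of a germ and of its inverse are inverse to each
    other, because they multiply to the Jacobian matrix of the identity. *)
Lemma det_jacobian_diffeo f : diffeo_germ f ->
  \forall p \near (0 : plane), \det ('J f p) != 0.
Proof.
move=> [f' [fC f'C ff' _]].
have fd := smooth_germ_differentiable fC.2.
have f'd := smooth_map_germ_near fC (smooth_germ_differentiable f'C.2).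
apply: filterS3 fd f'd (nbhs_interior ff') => p fd f'd ff'p.
have J1 : 'J f p *m 'J f' (f p) = 1%:M.
  apply: etrans (esym (jacobian_comp fd f'd)) _.
  apply: etrans (jacobian_id p); apply: near_eq_jacobian => //.
  exact: differentiable_comp.
by have [+ _] := mulmx1_unit J1; rewrite unitmxE unitfE.
Qed.

(** Critical points do not depend on the choice of coordinates in the source
    and in the target. *)
Lemma det_jacobian_comp3 f phi psi g q :
  differentiable phi q -> differentiable f (phi q) ->
  differentiable psi (f (phi q)) -> (\near q, g q = psi (f (phi q))) ->
  \det ('J phi q) != 0 -> \det ('J psi (f (phi q))) != 0 ->
  \det ('J g q) = 0 <-> \det ('J f (phi q)) = 0.
Proof.
move=> phid fd psid gE; have fphid := differentiable_comp phid fd.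
have sandwich (a b c d : R) : a = b * c * d -> b != 0 -> d != 0 ->
    a = 0 <-> c = 0.
  move=> -> b0 d0; split=> [/eqP|->]; last by rewrite mulr0 mul0r.
  by rewrite !mulf_eq0 (negbTE b0) (negbTE d0) orbF => /eqP.
have dE : \det ('J g q) =
    \det ('J phi q) * \det ('J f (phi q)) * \det ('J psi (f (phi q))).
  rewrite -!det_mulmx; congr (\det _).
  apply: etrans (congr1 (mulmx^~ _) (jacobian_comp phid fd)).
  apply: etrans (jacobian_comp fphid psid).
  apply/esym/near_eq_jacobian; first exact: differentiable_comp fphid psid.
  by apply: filterS gE => p ->.
exact: sandwich dE.
Qed.

(** On small neighbourhoods phi is a bijection between the critical points p of
    f and the critical points q = phi p of g, and g q = psi (f p). A
    neighbourhood U of the source of f is tested through its image by phi,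
    which is a neighbourhood in the source of g. *)
Lemma is_envelope_A_equivalent f g C : smooth_map_germ f ->
  A_equivalent f g -> is_envelope g C ->
  exists2 psi, diffeo_germ psi & is_envelope f (psi @^-1` C).
Proof.
move=> fC [phi [phi' [psi [phiD psiD gE]]]] [U0 nU0 envg].
exists psi => //.
have [phiC phi'C phi'phi phiphi'] := phiD.
have phi'D : diffeo_germ phi' by exists phi.
have [psi' [psiC psi'C psi'psi _]] := psiD.
have near_phi' := fun P => @smooth_map_germ_near phi' P phi'C.
have near_phi := fun P => @smooth_map_germ_near phi P phiC.
have detE : \forall q \near (0 : plane),
    \det ('J g q) = 0 <-> \det ('J f (phi' q)) = 0.
  have fd := near_phi' _ (smooth_germ_differentiable fC.2).
  have psid := near_phi' _ (smooth_map_germ_near fC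
    (smooth_germ_differentiable psiC.2)).
  have psiJ := near_phi' _ (smooth_map_germ_near fC (det_jacobian_diffeo psiD)).
  have phi'J := det_jacobian_diffeo phi'D.
  have phi'd := smooth_germ_differentiable phi'C.2.
  apply: filterS3 (filterI phi'd fd) (filterI psid (nbhs_interior gE))
    (filterI phi'J psiJ) => q [d1 d2] [d3 gq] [j1 j2].
  exact: det_jacobian_comp3 d1 d2 d3 gq j1 j2.
(* good consists of the points of the source of g at which g factors through f,
   phi' and psi' invert phi and psi, and being critical transfers. *)
pose good := [set q | [/\ g q = psi (f (phi' q)), phi (phi' q) = q,
  psi' (psi (f (phi' q))) = f (phi' q) &
  \det ('J g q) = 0 <-> \det ('J f (phi' q)) = 0]].
have ngood : nbhs (0 : plane) good.
  near=> q; split; near: q => //.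
  by exact: near_phi' _ (smooth_map_germ_near fC psi'psi).
exists [set p | [/\ U0 (phi p), good (phi p) & phi' (phi p) = p]].
  near=> p; split; near: p; [exact: near_phi|exact: near_phi|exact: phi'phi].
move=> U nU UU0.
have /(envg (good `&` phi' @^-1` U)) : good `&` phi' @^-1` U `<=` U0.
  by move=> q [[_ phiq _ _] /UU0[]]; rewrite phiq.
move/(_ (filterI ngood (near_phi' _ nU)))/(smooth_map_germ_near psiC).
apply: filterS2 psi'psi => p psi'p CE; apply: (iff_trans CE).
split=> [[q [[gq Uq] Jq] gqE]|[r [Ur Jr] frE]].
  have [gqf _ psiq Jgf] := gq.
  exists (phi' q); first exact: conj Uq (Jgf.1 Jq).
  rewrite /pi2_graph/= -psiq -gqf -[RHS]psi'p; congr psi'; exact: gqE.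
have [_ gr phi'r] := UU0 _ Ur; have [grf _ _ Jgf] := gr.
rewrite phi'r in grf Jgf.
have Uphir : U (phi' (phi r)) by rewrite phi'r.
exists (phi r); first exact: conj (conj gr Uphir) (Jgf.2 Jr).
by apply: etrans grf _; congr psi; exact: frE.
Unshelve. all: by end_near. Qed.

End Germs.

(** * Curves tangent to an axis *)

Section PlaneCurves.
Context {R : realType}.
Local Notation plane := 'rV[R]_2.

Lemma pt_eta (p : plane) : pt (fst_coord p) (snd_coord p) = p.
Proof.
apply/rowP => j; rewrite mxE.
case: ifPn => [/eqP ->//|j0]; congr (p _ _); apply: val_inj.
by case: j j0 => [[|[]]].
Qed.

Lemma fst_pt (a b : R) : fst_coord (pt a b) = a.
Proof. by rewrite /fst_coord mxE. Qed.

Lemma snd_pt (a b : R) : snd_coord (pt a b) = b.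
Proof. by rewrite /snd_coord mxE. Qed.

Lemma pt0 : pt 0 0 = 0 :> plane.
Proof. by apply/rowP => j; rewrite !mxE if_same. Qed.

Lemma Ck_pt n (u w : plane -> R^o) :
  Ck n setT u -> Ck n setT w -> Ck n setT (fun p => pt (u p) (w p)).
Proof.
have oT : open [set: plane] := openT.
move=> uC wC; apply/(Ck_coord _ _ oT) => j; have [j0|j0] := eqVneq j 0.
  by apply: Ck_eq uC => // p _; rewrite mxE j0.
by apply: Ck_eq wC => // p _; rewrite mxE (negbTE j0).
Qed.

Lemma Ck_coordinate n j : Ck n setT (fun p : plane => p 0 j : R^o).
Proof.
have oT : open [set: plane] := openT.
apply: ((Ck_coord n (fun p : plane => p) oT).1 _ j).
by apply: (@Ck_linear _ _ _ _ _ idfun) => x; exact: cvg_id.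
Qed.

(** The exponent k.+1 is positive, so that the origin is fixed. *)
Definition shear (c : R) (k : nat) (p : plane) : plane :=
  pt (fst_coord p) (snd_coord p + c * fst_coord p ^+ k.+1).

Lemma shearK c k : cancel (shear c k) (shear (- c) k).
Proof. by move=> p; rewrite /shear !fst_pt !snd_pt mulNr addrK pt_eta. Qed.

Lemma smooth_shear c k : smooth_map_germ (shear c k).
Proof.
split.
  by rewrite /shear /fst_coord /snd_coord !mxE expr0n mulr0 addr0 pt0.
exists setT => [|n]; first exact: open_nbhsT.
have oT : open [set: plane] := openT.
apply: Ck_pt; first exact: Ck_coordinate.
apply: (CkD oT (Ck_coordinate n 1)).
exact: (CkM oT (Ck_cst n setT (c : R^o)) (CkX k.+1 oT (Ck_coordinate n 0))).
Qed.

Lemma diffeo_shear c k : diffeo_germ (shear c k).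
Proof.
exists (shear (- c) k); split; [exact: smooth_shear|exact: smooth_shear| |].
  by near=> p; exact: shearK.
by near=> p; rewrite -[X in shear X](opprK c); exact: shearK.
Unshelve. all: by end_near. Qed.

Lemma diffeo_id : diffeo_germ (id : plane -> plane).
Proof.
rewrite (_ : id = shear 0 0); first exact: diffeo_shear.
by apply/funext => p; rewrite /shear mul0r addr0 pt_eta.
Qed.

Lemma smooth_curve_axis : smooth_curve_germ [set p : plane | snd_coord p = 0].
Proof.
by exists id; [exact: diffeo_id|near=> p].
Unshelve. all: by end_near. Qed.

(** In the identity chart the expansion is exact, with zero remainder; shears
    provide the chart that makes the graph a smooth curve. *)
Lemma order_tangency_monomial (c : R) k : c != 0 ->
  order_tangency k [set p : plane | snd_coord p = 0]
    [set p : plane | snd_coord p = c * fst_coord p ^+ k.+1].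
Proof.
move=> c0; split; first exact: smooth_curve_axis.
  exists (shear (- c) k); first exact: diffeo_shear.
  near=> p; rewrite /= snd_pt mulNr.
  by split=> [->|/eqP]; [rewrite subrr|rewrite subr_eq0 => /eqP].
exists id, (fun x => c * x ^+ k.+1), c; split.
- exact: diffeo_id.
- exists setT => [|n]; first exact: open_nbhsT.
  have oT : open [set: R^o] := openT.
  apply: (CkM oT (Ck_cst n setT (c : R^o))); apply: (CkX k.+1 oT).
  by apply: (@Ck_linear _ _ _ _ _ idfun) => x; exact: cvg_id.
- split=> //; apply/eqoP => e e0; near=> x.
  by rewrite subrr normr0 mulr_ge0// ltW.
- by near=> p.
- by near=> p.
Unshelve. all: by end_near. Qed.

Lemma self_tangency_monomial (c : R) k : c != 0 ->
  self_tangency k ([set p : plane | snd_coord p = 0] `|`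
    [set p : plane | snd_coord p = c * fst_coord p ^+ k.+1]).
Proof.
move=> c0; eexists; eexists; split; first exact: order_tangency_monomial c0.
by near=> p; split.
Unshelve. all: by end_near. Qed.

(** * Envelopes of the two normal forms *)

Lemma det_mx2 (A : 'M[R]_2) : \det A = A 0 0 * A 1 1 - A 0 1 * A 1 0.
Proof.
rewrite (expand_det_row _ 0) !big_ord_recl big_ord0 /cofactor !det_mx11 !mxE.
rewrite /= !expr0 !expr1 !mul1r addr0 mulN1r mulrN.
by congr (_ * _ - _ * _); congr (A _ _); apply: val_inj.
Qed.

Lemma jacobian_coord m n (f : 'rV[R]_m -> 'rV[R]_n) x i j :
  differentiable f x -> 'J f x i j = 'D_('e_i) (fun q => f q 0 j : R^o) x.
Proof.
move=> fd.
have /rowP/(_ j) := row_jacobian i fd.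
rewrite derive_mx; last exact: diff_derivable.
by rewrite mxE => ->; rewrite mxE.
Qed.

Lemma det_jacobian_pt (u w : plane -> R^o) p (du dw : plane -> R) :
  differentiable (fun q => pt (u q) (w q)) p ->
  (forall v, is_derive p v u (du v)) -> (forall v, is_derive p v w (dw v)) ->
  \det ('J (fun q => pt (u q) (w q)) p) =
  du (pt 1 0) * dw (pt 0 1) - dw (pt 1 0) * du (pt 0 1).
Proof.
move=> fd ud wd.
have J0 i : 'J (fun q => pt (u q) (w q)) p i 0 = du 'e_i.
  have uE : (fun q => pt (u q) (w q) 0 0 : R^o) = u.
    by apply/funext => q; exact: fst_pt.
  apply: etrans (jacobian_coord i 0 fd) _.
  apply: etrans (congr1 (fun h => derive h p 'e_i) uE) _.
  by have [_] := ud 'e_i.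
have J1 i : 'J (fun q => pt (u q) (w q)) p i 1 = dw 'e_i.
  have wE : (fun q => pt (u q) (w q) 0 1 : R^o) = w.
    by apply/funext => q; exact: snd_pt.
  apply: etrans (jacobian_coord i 1 fd) _.
  apply: etrans (congr1 (fun h => derive h p 'e_i) wE) _.
  by have [_] := wd 'e_i.
have e0 : 'e_0 = pt 1 0 :> plane.
  by apply/rowP => j; rewrite !mxE eqxx; case: eqP.
have e1 : 'e_1 = pt 0 1 :> plane.
  by apply/rowP => j; rewrite !mxE eqxx; case: j => [[|[|]]].
by apply: etrans (det_mx2 _) _; rewrite !J0 !J1 e0 e1.
Qed.

Lemma is_derive_coordinate (p v : plane) j :
  is_derive p v (fun q : plane => q 0 j : R^o) (v 0 j).
Proof.
have cd : differentiable (fun q : plane => q 0 j : R^o) p.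
  exact: differentiable_coord.
apply: DeriveDef; first exact: diff_derivable.
have := @derive_mx R plane 1 2 id p v (@derivable_id _ _ p v).
by rewrite derive_id => /matrixP/(_ 0 j) ->; rewrite mxE.
Qed.

Lemma det_jacobian_normal_form_I (p : plane) :
  \det ('J (@normal_form_I R) p) = 2 * snd_coord p.
Proof.
have oT : open [set: plane] := openT.
have [X T] := (Ck_coordinate 1 0, Ck_coordinate 1 1).
have [nfd _] := Ck_pt (CkD oT X T) (CkX 2 oT T).
have dX v := is_derive_coordinate p v 0.
have dT v := is_derive_coordinate p v 1.
have du v : is_derive p v (fun q : plane => fst_coord q + snd_coord q : R^o)
  (v 0 0 + v 0 1) := is_deriveD (dX v) (dT v).
have dw v : is_derive p v (fun q : plane => snd_coord q ^+ 2 : R^o)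
    (2 * snd_coord p * v 0 1).
  have T2 : is_derive p v (fun q : plane => snd_coord q ^+ 2 : R^o) _ :=
    is_deriveX 2 (dT v).
  by apply: is_derive_eq T2 _; rewrite expr1.
apply: etrans (det_jacobian_pt (nfd p I) du dw) _.
by rewrite !mxE /=; ring.
Qed.

Lemma det_jacobian_normal_form_II (p : plane) :
  \det ('J (@normal_form_II R) p) =
  snd_coord p * (2 * fst_coord p - snd_coord p).
Proof.
have oT : open [set: plane] := openT.
have [X T] := (Ck_coordinate 1 0, Ck_coordinate 1 1).
have [nfd _] := Ck_pt (CkD oT X T) (CkM oT (CkX 2 oT T) X).
have dX v := is_derive_coordinate p v 0.
have dT v := is_derive_coordinate p v 1.
have du v : is_derive p v (fun q : plane => fst_coord q + snd_coord q : R^o)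
  (v 0 0 + v 0 1) := is_deriveD (dX v) (dT v).
have dw v : is_derive p v
    (fun q : plane => snd_coord q ^+ 2 * fst_coord q : R^o)
    (snd_coord p ^+ 2 * v 0 0 + 2 * fst_coord p * snd_coord p * v 0 1).
  have T2X : is_derive p v
      (fun q : plane => snd_coord q ^+ 2 * fst_coord q : R^o) _ :=
    is_deriveM (is_deriveX 2 (dT v)) (dX v).
  apply: is_derive_eq T2X _.
  apply: (congr1 (+%R (snd_coord p ^+ 2 * v 0 0))).
  by rewrite /GRing.scale /= /fst_coord /snd_coord; ring.
apply: etrans (det_jacobian_pt (nfd p I) du dw) _.
by rewrite !mxE /=; ring.
Qed.

(** The critical line t = 0 is fixed pointwise by the map. *)
Lemma is_envelope_normal_form_I :
  is_envelope (@normal_form_I R) [set p | snd_coord p = 0].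
Proof.
exists setT => [|U nU _]; first exact: filterT.
near=> p; split=> [p0|[q [_ Jq] <-]].
  exists p; last first.
    by rewrite -[RHS]pt_eta /pi2_graph/= /normal_form_I p0 addr0 expr0n.
  split; first by near: p.
  by apply: etrans (det_jacobian_normal_form_I p) _; rewrite p0 mulr0.
rewrite /= snd_pt.
have /eqP := etrans (esym (det_jacobian_normal_form_I q)) Jq.
by rewrite mulf_eq0 pnatr_eq0 /= => /eqP ->; rewrite expr0n.
Unshelve. all: by end_near. Qed.

(** The line t = 2 xi is mapped bijectively to the cubic: the critical point
    above (x, y) is (x/3, 2x/3), as xi + t = 3 xi there. *)
Lemma is_envelope_normal_form_II :
  is_envelope (@normal_form_II R)
    ([set p | snd_coord p = 0] `|`
     [set p | snd_coord p = 4 / 27 * fst_coord p ^+ 3]).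
Proof.
exists setT => [|U nU _]; first exact: filterT.
pose crit (p : plane) := pt (fst_coord p / 3) (fst_coord p * (2 / 3)).
have near_crit : \forall p \near (0 : plane), U (crit p).
  have critC : Ck 0 setT crit.
    have oT : open [set: plane] := openT.
    have cC (c : R^o) := CkM oT (Ck_coordinate 0 0) (Ck_cst 0 setT c).
    exact: Ck_pt (cC _) (cC _).
  apply: (critC 0 I); rewrite /crit /fst_coord !mxE !mul0r pt0; exact: nU.
near=> p; split=> [[/= p0|/= pE]|[q [_ Jq] <-]].
- exists p; last first.
    by rewrite -[RHS]pt_eta /pi2_graph/= /normal_form_II p0 addr0 expr0n mul0r.
  split; first by near: p.
  by apply: etrans (det_jacobian_normal_form_II p) _; rewrite p0 mul0r.
- exists (crit p); last first.
    rewrite -[RHS]pt_eta pE /pi2_graph/= /normal_form_II /crit !fst_pt !snd_pt.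
    by congr pt; field.
  split; first by near: p.
  apply: etrans (det_jacobian_normal_form_II (crit p)) _.
  by rewrite !fst_pt !snd_pt; field.
- rewrite /= /normal_form_II !snd_pt !fst_pt.
  have /eqP := etrans (esym (det_jacobian_normal_form_II q)) Jq.
  rewrite mulf_eq0 subr_eq0 => /orP[/eqP ->|/eqP <-]; [left|right].
    by rewrite expr0n mul0r.
  by field.
Unshelve. all: by end_near. Qed.

End PlaneCurves.

Theorem mainTheorem2 (R : realType) :
  (forall f : 'rV[R]_2 -> 'rV[R]_2,
     tangential_family_germ f -> has_singularity_I f ->
     exists2 E : set 'rV[R]_2, is_envelope f E & smooth_curve_germ E) /\
  (forall f : 'rV[R]_2 -> 'rV[R]_2,
     tangential_family_germ f -> has_singularity_II f ->
     exists2 E : set 'rV[R]_2, is_envelope f E & self_tangency 2 E).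
Proof.
split=> f [fC _] fS.
  have [psi psiD fE] :=
    is_envelope_A_equivalent fC fS (@is_envelope_normal_form_I R).
  by exists (psi @^-1` [set p | snd_coord p = 0]) => //;
    apply: smooth_curve_germ_preimage psiD _; exact: smooth_curve_axis.
have [psi psiD fE] :=
  is_envelope_A_equivalent fC fS (@is_envelope_normal_form_II R).
eexists; first exact: fE.
apply: self_tangency_preimage psiD _; apply: self_tangency_monomial.
by apply: lt0r_neq0; rewrite divr_gt0.
Qed.
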